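(* Let $G=(V,E)$ be a connected locally finite graph and let $F\subseteq E$. Then the indicator function $\delta_F:E\to\mathbb{Z}_2$ (with $\delta_F(e)=1$ if $e\in F$ and $\delta_F(e)=0$ if $e\notin F$) is a $\mathbb{Z}_2$-flow of $G$ if and only if $F\in\mathcal{C}(G)$.
   Context: A map $f:E\to\mathbb{Z}_2$ is a $\mathbb{Z}_2$-flow of $G$ if $\sum_{e\in C}f(e)=0$ in $\mathbb{Z}_2$ for every finite cut $C$ of $G$, where a cut is the set of all edges between $X$ and $V\setminus X$ for some $X\subseteq V$ (orientations are irrelevant over $\mathbb{Z}_2$). For a locally finite connected graph $G$, $|G|$ denotes the Freudenthal compactification of $G$ viewed as a $1$-dimensional CW complex (i.e. $G$ together with its ends). A circle in $|G|$ is a homeomorphic image of $S^1$ in $|G|$; a circuit is the set of edges of $G$ contained in some circle. $\mathcal{C}(G)$ is the topological cycle space of $G$: the set of all edge sets that are sums (mod 2) of thin families of circuits, where a family of edge sets is thin if every edge lies in only finitely many members of the family. *)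

(* Defs.v *)
From HB Require Import structures.
From mathcomp Require Import all_boot all_order all_algebra.
From mathcomp Require Import all_classical all_reals all_analysis.
Import numFieldNormedType.Exports.
Import Order.TTheory GRing.Theory Num.Theory.

Set Implicit Arguments.
Unset Strict Implicit.
Unset Printing Implicit Defensive.

Local Open Scope classical_set_scope.
Local Open Scope ring_scope.

(* Graphs of arbitrary cardinality, with loops and parallel edges allowed.    *)
(* The order of the two ends of an edge only fixes a parametrisation of that  *)
(* edge; every notion below is invariant under exchanging them.               *)
Record graph := Graph {
  vertex : choiceType;
  edge : choiceType;
  src : edge -> vertex;
  tgt : edge -> vertex }.

Section Combinatorics.
Variable G : graph.
Implicit Types (u v : vertex G) (e : edge G).

Definition incident v e : Prop := src e = v \/ tgt e = v.

Definition adjacent u v : Prop :=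
  exists e, (src e = u /\ tgt e = v) \/ (src e = v /\ tgt e = u).

(* As usual, a connected graph is nonempty. *)
Definition connected_graph : Prop :=
  inhabited (vertex G) /\
  forall u v, exists p : seq (vertex G),
    path (fun x y => `[< adjacent x y >]) u p /\ last u p = v.

Definition locally_finite : Prop :=
  forall v, finite_set [set e | incident v e].

Definition edge_cut (X : set (vertex G)) : set (edge G) :=
  [set e | (X (src e) /\ ~ X (tgt e)) \/ (X (tgt e) /\ ~ X (src e))].

Definition Z2_flow (f : edge G -> 'Z_2) : Prop :=
  forall X : set (vertex G), finite_set (edge_cut X) ->
    \sum_(e \in edge_cut X) f e = 0.

Definition delta (F : set (edge G)) : edge G -> 'Z_2 := \1_F.

(* Each edge lies in finitely many members, counted with multiplicity: the    *)
(* same set may be the value of the family at several indices.                *)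
Definition thin (I : Type) (D : I -> set (edge G)) : Prop :=
  forall e, finite_set [set i | D i e].

End Combinatorics.

(* The underlying set of G as a 1-dimensional CW complex over the reals R:    *)
(* 0-cells and open 1-cells.                                                  *)
Variant realization (R : realType) (G : graph) : Type :=
  | VertexPoint of vertex G
  | InnerPoint of edge G & {t : R | 0 < t < 1}.

HB.instance Definition _ R G := gen_eqMixin (realization R G).
HB.instance Definition _ R G := gen_choiceMixin (realization R G).

Section Realization.
Variables (R : realType) (G : graph).
Local Notation rG := (realization R G).

(* The characteristic map of the 1-cell e; only its values on [0, 1] matter.  *)
Definition char_map (e : edge G) (t : R) : rG :=
  if insub t is Some u then InnerPoint e u
  else VertexPoint R (if t <= 0 then src e else tgt e).

Definition closed_edge (e : edge G) : set rG := char_map e @` `[0, 1].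

(* The CW topology: U is open iff its preimage under the characteristic map   *)
(* of every cell is relatively open (nothing to require for 0-cells).         *)
Definition realization_open (U : set rG) : Prop :=
  forall e, @open (subspace (`[0, 1] : set R)) (char_map e @^-1` U).

Let realization_openT : realization_open setT.
Proof. by move=> e; rewrite preimage_setT; exact: openT. Qed.

Let realization_openI : setI_closed realization_open.
Proof. by move=> U V oU oV e; rewrite preimage_setI; exact: openI. Qed.

Let realization_open_bigU (I : Type) (U : I -> set rG) :
  (forall i, realization_open (U i)) -> realization_open (\bigcup_i U i).
Proof.
by move=> oU e; rewrite preimage_bigcup; apply: bigcup_open => i _; exact: oU.
Qed.

HB.instance Definition _ := isOpenTopological.Build rG
  realization_openT realization_openI realization_open_bigU.

End Realization.

(* An end of a space X: a choice, for every compact K, of a connected         *)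
(* component of X \ K, compatible with inclusions K `<=` L; that is, an       *)
(* element of the inverse limit over K of the components of X \ K.            *)
Record topological_end (X : topologicalType) := TopologicalEnd {
  end_component : {K : set X | compact K} -> set X;
  end_componentP : forall K,
    exists2 x, ~ sval K x &
      end_component K = connected_component (~` sval K) x;
  end_component_sub : forall K L,
    sval K `<=` sval L -> end_component L `<=` end_component K }.

(* This is the Freudenthal compactification for connected, locally connected, *)
(* locally compact, sigma-compact Hausdorff X, which includes the             *)
(* realizations of connected locally finite graphs.                           *)
Variant freudenthal (X : topologicalType) : Type :=
  | SpacePoint of X
  | EndPoint of topological_end X.

HB.instance Definition _ X := gen_eqMixin (freudenthal X).
HB.instance Definition _ X := gen_choiceMixin (freudenthal X).

Section Freudenthal.
Variable X : topologicalType.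
Local Notation fX := (freudenthal X).
Implicit Types (w : topological_end X) (K : {K : set X | compact K}).

(* The component C of X \ K selected by w, with all the ends living in C.     *)
Definition end_nbhd w K : set fX :=
  [set p | match p with
           | SpacePoint x => end_component w K x
           | EndPoint w' => end_component w' K = end_component w K
           end].

Definition freudenthal_open (U : set fX) : Prop :=
  open (@SpacePoint X @^-1` U) /\
  forall w, U (EndPoint w) -> exists K, end_nbhd w K `<=` U.

Let freudenthal_openT : freudenthal_open setT.
Proof.
split; first by rewrite preimage_setT; exact: openT.
by move=> w _; exists (exist _ set0 (@compact0 X)).
Qed.

Let end_nbhd_sub w K L : sval K `<=` sval L -> end_nbhd w L `<=` end_nbhd w K.
Proof.
move=> KL [x|w'] /=; first exact: end_component_sub.
move=> eqL.
have [x nLx Lx] := end_componentP w L.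
have wLx : end_component w L x by rewrite Lx; exact: connected_component_refl.
have w'Kx : end_component w' K x.
  by apply: (end_component_sub KL); rewrite eqL.
have wKx : end_component w K x by exact: (end_component_sub KL).
have [y _ Ky] := end_componentP w K; have [z _ Kz] := end_componentP w' K.
move: w'Kx wKx; rewrite Ky Kz => zx yx.
by rewrite (same_connected_component zx) (same_connected_component yx).
Qed.

Let freudenthal_openI : setI_closed freudenthal_open.
Proof.
move=> U V [oU wU] [oV wV]; split; first by rewrite preimage_setI; exact: openI.
move=> w [/wU[K KU] /wV[L LV]].
exists (exist _ _ (compactU (proj2_sig K) (proj2_sig L))) => p wp; split.
- by apply: KU; apply: end_nbhd_sub wp => ? ?; left.
- by apply: LV; apply: end_nbhd_sub wp => ? ?; right.
Qed.

Let freudenthal_open_bigU (I : Type) (U : I -> set fX) :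
  (forall i, freudenthal_open (U i)) -> freudenthal_open (\bigcup_i U i).
Proof.
move=> oU; split.
  by rewrite preimage_bigcup; apply: bigcup_open => i _; have [] := oU i.
move=> w [i _ Uiw]; have [_ /(_ _ Uiw)[K KU]] := oU i.
by exists K => p /KU Uip; exists i.
Qed.

HB.instance Definition _ := isOpenTopological.Build fX
  freudenthal_openT freudenthal_openI freudenthal_open_bigU.

End Freudenthal.

Definition homeomorphic (S T : topologicalType) (A : set S) (B : set T) : Prop :=
  exists (f : S -> T) (g : T -> S),
    [/\ {within A, continuous f}, {within B, continuous g},
        f @` A = B & {in A, cancel f g}].

Definition unit_circle (R : realType) : set (R * R) :=
  [set z | z.1 ^+ 2 + z.2 ^+ 2 = 1].

Arguments unit_circle : clear implicits.

Section TopologicalCycleSpace.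
Variables (R : realType) (G : graph).
Local Notation compG := (freudenthal (realization R G)).

Definition circle (C : set compG) : Prop := homeomorphic (unit_circle R) C.

Definition edges_in (C : set compG) : set (edge G) :=
  [set e | @SpacePoint _ @` @closed_edge R G e `<=` C].

Definition circuit (D : set (edge G)) : Prop :=
  exists2 C, circle C & D = edges_in C.

(* The index type of a family is arbitrary (possibly empty); the sum of a     *)
(* thin family is taken edge by edge, with finitely many nonzero terms.       *)
Definition cycle_space : set (set (edge G)) :=
  [set F | exists (I : choiceType) (D : I -> set (edge G)),
    [/\ forall i, circuit (D i), thin D &
        forall e, delta F e = \sum_(i \in [set: I]) delta (D i) e]].

End TopologicalCycleSpace.

Arguments cycle_space : clear implicits.

(* Main.v *)
Require Import Defs.
From mathcomp Require Import all_boot all_order all_algebra.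
From mathcomp Require Import all_classical all_reals all_analysis.
From mathcomp Require Import finmap ring lra.
Import numFieldNormedType.Exports.
Import Order.TTheory GRing.Theory Num.Theory.
Set Implicit Arguments.
Unset Strict Implicit.
Unset Printing Implicit Defensive.
Local Open Scope classical_set_scope.
Local Open Scope ring_scope.

(** The proof treats the two implications by unrelated means.

A sum of circuits is a flow.  A finite cut between [X] and its complement
yields a continuous function [phi : |G| -> R] which is 1 on [X], 0 on the
other vertices and affine on every edge; it extends to the ends because the
complement of the finitely many cut edges has [phi] constant on each of its
components ([extend_to_ends], [cut_function]).  Run once around a circle [C]
and compare [phi] with a level [c] strictly between 0 and 1 that is not the
value at the base point.  The level is attained only in the interior of cut
edges, once on each; there [phi] is injective, so along the circle it is
strictly monotone and really crosses the level.  The circle returns to its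
base point, so the number of crossings is even ([switch_parity]).  An open and
closed argument shows that a circle meeting the interior of a cut edge
contains that edge ([circle_contains_edge]), so the crossings correspond to
the edges of the circuit in the cut ([circle_meets_cut_evenly]).  As every
edge of a finite cut lies in finitely many members of a thin family, the sum
over the cut may be exchanged with the sum over the family.

A flow is a sum of circuits.  Finite cycles suffice, so that no circle through
an end has to be built.  The edges of [G] are countable; rank them.
Let [e0] be the first edge on which a flow is nonzero.  If no cycle passes
through [e0] and otherwise only through edges of larger rank, then the
vertices reachable from one end of [e0] by edges of larger rank define a cut
that contains [e0] and has only edges of rank at most that of [e0].  It is
finite and the flow is nonzero on exactly one of its edges, a contradiction
([circuit_through_first_edge]).  So a circuit through [e0] with no edge of
smaller rank exists, and adding it to the flow gives a flow that vanishes up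
to and including [e0].  Iterating, every edge is settled after finitely many
steps and is never touched again; the circuits used therefore form a thin
family with the given sum ([flow_cycle_space]).

Finally, a finite cycle has to be recognised as a circle.  It is traversed by
a closed path, injective but for its endpoints ([path_arc], [path_circuit]),
and such a path factors through the unit circle.  The inverse is continuous by
compactness, for which |G| need not be shown to be Hausdorff: each point of
[G] is the only zero of some continuous function on |G| ([point_function]),
so it has a neighbourhood missing any given compact set that does not contain
it ([compact_avoid]). *)

(** * Points of the realization and continuous functions on |G| *)

Section Cells.
Variables (R : realType) (G : graph).
Local Notation rG := (realization R G).
Local Notation cG := (freudenthal rG).
Implicit Types (e : edge G) (v : vertex G) (t : R).

Definition edge_pt e t : cG := SpacePoint (char_map e t).
Definition vertex_pt v : cG := SpacePoint (VertexPoint R v).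

Lemma char_map_inner e t (t01 : 0 < t < 1) :
  char_map e t = InnerPoint e (exist _ t t01).
Proof.
rewrite /char_map insubT; congr (InnerPoint e _); exact/val_inj.
Qed.

Lemma char_map_le0 e t : t <= 0 -> char_map e t = VertexPoint R (src e).
Proof. by move=> t0; rewrite /char_map insubF ?t0// ltNge t0. Qed.

Lemma char_map_ge1 e t : 1 <= t -> char_map e t = VertexPoint R (tgt e).
Proof.
move=> t1; rewrite /char_map insubF; last by rewrite (ltNge t) t1 andbF.
by rewrite leNgt (lt_le_trans ltr01 t1).
Qed.

Lemma realizationP (x : rG) :
  (exists v, x = VertexPoint R v) \/
  (exists e t, 0 < t < 1 /\ x = char_map e t).
Proof.
case: x => [v|e [t t01]]; [by left; exists v|right; exists e, t].
by rewrite (char_map_inner e t01).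
Qed.

Lemma char_map_inj e e' t t' : 0 < t < 1 ->
  char_map e t = char_map e' t' -> e = e' /\ t = t'.
Proof.
move=> t01; rewrite (char_map_inner e t01).
have [t'0|t'0] := leP t' 0; first by rewrite char_map_le0.
have [t'1|t'1] := leP 1 t'; first by rewrite char_map_ge1.
have t'01 : 0 < t' < 1 by rewrite t'0.
by rewrite (char_map_inner e' t'01) => -[-> ->].
Qed.

Definition clamp t : R := Num.max 0 (Num.min t 1).

Lemma clamp_le0 t : t <= 0 -> clamp t = 0.
Proof. by move=> t0; rewrite /clamp min_l ?max_l//; lra. Qed.

Lemma clamp_ge1 t : 1 <= t -> clamp t = 1.
Proof. by move=> t1; rewrite /clamp min_r ?max_r//; lra. Qed.

Lemma clamp_id t : 0 <= t <= 1 -> clamp t = t.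
Proof. by move=> t01; rewrite /clamp min_l ?max_r//; lra. Qed.

Lemma clamp_itv t : 0 <= clamp t <= 1.
Proof.
have [t0|t0] := leP t 0; first by rewrite clamp_le0//; lra.
have [t1|t1] := leP 1 t; first by rewrite clamp_ge1//; lra.
by rewrite clamp_id; lra.
Qed.

Lemma clamp_continuous : continuous clamp.
Proof.
have -> : clamp = (cst 0 : R -> R^o) \max ((id : R -> R^o) \min cst 1) by [].
move=> t; apply: continuous_max; first exact: cvg_cst.
by apply: continuous_min; [exact: cvg_id|exact: cvg_cst].
Qed.

Lemma char_map_clamp e t : char_map e (clamp t) = char_map e t.
Proof.
have [t0|t0] := leP t 0; first by rewrite clamp_le0// !char_map_le0.
have [t1|t1] := leP 1 t; first by rewrite clamp_ge1// !char_map_ge1.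
by rewrite clamp_id//; lra.
Qed.

Lemma open_realization (U : set rG) : realization_open U -> open U.
Proof. by []. Qed.

(** The topology only controls preimages relatively to [[0, 1]]; the retraction
[clamp] of the line onto [[0, 1]] makes the map continuous on the whole line,
which spares restrictions to subspaces later on. *)
Lemma char_map_continuous e : continuous (char_map e : R -> rG).
Proof.
apply/continuousP => U /(_ e) /open_subspaceP[V oV VU].
suff -> : char_map e @^-1` U = clamp @^-1` V.
  by move/continuousP: clamp_continuous; exact.
rewrite predeqE => t; rewrite /preimage /= -char_map_clamp.
have /(congr1 (fun A => A (clamp t))) /= := VU.
by rewrite in_itv/= clamp_itv /setI /= => H; split => ?;
  [have [] : V (clamp t) /\ true by rewrite H|
   have [] : U (char_map e (clamp t)) /\ true by rewrite -H].
Qed.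

Lemma SpacePoint_continuous (X : topologicalType) : continuous (@SpacePoint X).
Proof. by apply/continuousP => U []. Qed.

Lemma edge_pt_continuous e : continuous (edge_pt e).
Proof.
move=> t; apply: (@continuous_comp _ _ _ (char_map e) (@SpacePoint rG)).
  exact: char_map_continuous.
exact: SpacePoint_continuous.
Qed.

Lemma edge_pt_le0 e t : t <= 0 -> edge_pt e t = vertex_pt (src e).
Proof. by move=> ?; rewrite /edge_pt char_map_le0. Qed.
Lemma edge_pt_ge1 e t : 1 <= t -> edge_pt e t = vertex_pt (tgt e).
Proof. by move=> ?; rewrite /edge_pt char_map_ge1. Qed.

Lemma edge_pt_inj e e' t t' : 0 < t < 1 -> edge_pt e t = edge_pt e' t' -> e = e' /\ t = t'.
Proof. by move=> t01 [] /(char_map_inj t01). Qed.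

Lemma edge_pt_neq_vertex e t v : 0 < t < 1 -> edge_pt e t <> vertex_pt v.
Proof. by move=> t01; rewrite /edge_pt (char_map_inner e t01). Qed.

Lemma realization_continuous (T : topologicalType) (h : rG -> T) :
  (forall e, {within `[0, 1], continuous (h \o char_map e)}) -> continuous h.
Proof.
move=> hc; apply/continuousP => U oU; apply: open_realization => e.
by have /continuousP/(_ _ oU) := hc e.
Qed.

Lemma open_edge_open e : open [set edge_pt e t | t in [set t | 0 < t < 1]].
Proof.
split; last by move=> w [].
apply: open_realization => e'; apply/open_subspaceP.
have [->|/eqP ee'] := eqVneq e' e.
  exists (`]0, 1[%classic : set R); first exact: itv_open.
  rewrite predeqE => t; split=> -[]; rewrite /= !in_itv/= => t01 t01'; split => //.
    by exists t.
  by case: t01 => s s01 /(edge_pt_inj s01)[_ <-].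
exists set0; first exact: open0.
rewrite set0I predeqE => t; split=> // -[] /= [s s01 /(edge_pt_inj s01)[ee _]] _.
exact: ee'.
Qed.

Lemma closed_edge_compact e : compact (@closed_edge R G e).
Proof.
apply: continuous_compact; last exact: segment_compact.
exact/continuous_subspaceT/char_map_continuous.
Qed.

Lemma closed_edges_compact (S : set (edge G)) : finite_set S ->
  compact (\bigcup_(e in S) @closed_edge R G e).
Proof.
move=> Sfin; rewrite -bigsetU_fset_set//; apply: bigsetU_compact => e _.
exact: closed_edge_compact.
Qed.

Definition edge_constant (h : rG -> R) e : Prop :=
  forall t, h (char_map e t) = h (VertexPoint R (src e)).

(** The interiors of the edges inside [K] together with any union of level sets
of [h] form an open set: near a vertex, [h] can only change along an edge
inside [K], and the whole interior of that edge has been included.  Outside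
[K] the level sets are thus both open and closed. *)
Lemma constant_on_component (h : rG -> R) (K A : set rG) :
  (forall e, edge_constant h e \/ @closed_edge R G e `<=` K) ->
  A `<=` ~` K -> connected A -> forall x y, A x -> A y -> h x = h y.
Proof.
move=> hK AK Ac x y Ax Ay.
(* The points that are added to a union of level sets to make it open. *)
pose inner : set rG := [set z | exists e t, [/\ @closed_edge R G e `<=` K,
  0 < t < 1 & z = char_map e t]].
have innerK : inner `<=` K.
  move=> _ [e [t [eK t01 ->]]]; apply: eK; exists t => //=.
  by rewrite in_itv/=; lra.
have oW (Q : set R) : open (inner `|` h @^-1` Q).
  apply: open_realization => e; apply/open_subspaceP.
  have [eK|neK] := pselect (@closed_edge R G e `<=` K).
    pose V := `]0, 1[%classic `|` ([set t | Q (h (VertexPoint R (src e)))] `&` [set t | t < 1])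
      `|` ([set t | Q (h (VertexPoint R (tgt e)))] `&` [set t | 0 < t]) : set R.
    have oP (P : Prop) : open [set t : R | P].
      have [p|np] := pselect P.
        by rewrite (_ : [set _ | _] = setT) ?predeqE//; exact: openT.
      by rewrite (_ : [set _ | _] = set0) ?predeqE//; exact: open0.
    exists V.
      apply: openU; first apply: openU; first exact: itv_open.
        by apply: openI; [exact: oP|exact: open_lt].
      by apply: openI; [exact: oP|exact: open_gt].
    rewrite predeqE => t; split => -[] Pt t01; split => //.
      move: Pt t01; rewrite /V /= !in_itv/= => -[[t01|[Qt t1]]|[Qt t0]] t01'.
      - by left; exists e, t.
      - have [t0|t0] := leP t 0; first by right; rewrite /preimage/= char_map_le0.
        by left; exists e, t; split => //; lra.
      - have [t1|t1] := leP 1 t; first by right; rewrite /preimage/= char_map_ge1.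
        by left; exists e, t; split => //; lra.
    move: t01; rewrite /V /= !in_itv/= => t01.
    have [t0|t0] := leP t 0.
      left; right; split; last lra.
      by case: Pt => [[? [? [_ s01]]]|]; rewrite /preimage/= char_map_le0//;
        rewrite (char_map_inner _ s01).
    have [t1|t1] := leP 1 t.
      right; split; last lra.
      by case: Pt => [[? [? [_ s01]]]|]; rewrite /preimage/= char_map_ge1//;
        rewrite (char_map_inner _ s01).
    by left; left; lra.
  have he : edge_constant h e by case: (hK e).
  have [Qe|Qe] := pselect (Q (h (VertexPoint R (src e)))).
    exists setT; first exact: openT.
    rewrite predeqE => t; split => -[] //= _ t01; split => //; right.
    by rewrite /preimage /= he.
  exists set0; first exact: open0.
  rewrite predeqE => t; split => -[] //= -[[e' [s [e'K s01 E]]]|].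
    by have [Ee _] := char_map_inj s01 (esym E); rewrite Ee in e'K.
  by rewrite /preimage /= he.
pose Q := [set h x].
have BA : A `&` h @^-1` Q = A.
  apply: Ac; first by exists x.
    exists (inner `|` h @^-1` Q) => //.
    rewrite predeqE => z; split=> -[Az]; first by split => //; right.
    by case=> // /innerK /AK.
  exists (~` (inner `|` h @^-1` (~` Q))); first exact: open_closedC.
  rewrite predeqE => z; split=> -[Az hz]; split => //.
    by case=> // /innerK; exact: AK.
  by apply: contrapT => hzQ; apply: hz; right.
by have [_ /= ->] : (A `&` h @^-1` Q) y by rewrite BA.
Qed.

(** An end picks a component of the complement of [K], on which [h] is constant;
that constant is the value at the end, and it is also the value of [h] on a
whole neighbourhood of the end. *)
Lemma extend_to_ends (h : rG -> R) (K : set rG) :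
  continuous h -> compact K ->
  (forall e, edge_constant h e \/ @closed_edge R G e `<=` K) ->
  exists H : cG -> R, [/\ continuous H, forall x, H (SpacePoint x) = h x &
    forall w, exists2 x, ~ K x & H (EndPoint w) = h x].
Proof.
move=> hc Kc hK.
pose K' : {K : set rG | compact K} := exist _ K Kc.
have /choice[r rP] (w : topological_end rG) :
    exists x, ~ K x /\ end_component w K' = connected_component (~` K) x.
  by have [x ? ?] := end_componentP w K'; exists x.
have wr w : end_component w K' (r w).
  by have [? ->] := rP w; exact: connected_component_refl.
have rE w x : end_component w K' x -> h x = h (r w).
  move=> wx; apply: (constant_on_component hK _ _ wx (wr w)).
    by have [_ ->] := rP w; exact: connected_component_sub.
  by have [_ ->] := rP w; exact: component_connected.
pose H (p : cG) := match p with SpacePoint x => h x | EndPoint w => h (r w) end.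
exists H; split => //; last by move=> w; exists (r w) => //; have [] := rP w.
apply/continuousP => U oU; split.
  by have /continuousP/(_ _ oU) := hc.
move=> w; rewrite /preimage /= => Uw; exists K' => -[x|w'] /=.
  by move=> /rE ->.
by move=> ww'; rewrite (rE w)// -ww'.
Qed.
End Cells.

Section Functions.
Variables (R : realType) (G : graph).
Local Notation rG := (realization R G).
Local Notation cG := (freudenthal rG).
Implicit Types (e : edge G) (v : vertex G) (t : R).

Section Glue.
Variables (a : vertex G -> R) (psi : edge G -> R -> R).
Hypothesis psi0 : forall e, psi e 0 = a (src e).
Hypothesis psi1 : forall e, psi e 1 = a (tgt e).
Hypothesis psi_continuous : forall e, continuous (psi e).

Definition glue (x : rG) : R :=
  match x with VertexPoint v => a v | InnerPoint e u => psi e (sval u) end.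

Lemma glue_char_map e t : glue (char_map e t) = psi e (clamp t).
Proof.
have [t0|t0] := leP t 0; first by rewrite clamp_le0// char_map_le0//= psi0.
have [t1|t1] := leP 1 t; first by rewrite clamp_ge1// char_map_ge1//= psi1.
have t01 : 0 < t < 1 by lra.
by rewrite clamp_id ?(char_map_inner _ t01)//; lra.
Qed.

Lemma glue_continuous : continuous glue.
Proof.
apply: realization_continuous => e; apply: continuous_subspaceT => t.
rewrite (_ : glue \o _ = psi e \o @clamp R); last first.
  by apply/funext => s /=; rewrite glue_char_map.
by apply: continuous_comp; [exact: clamp_continuous|exact: psi_continuous].
Qed.
End Glue.

Lemma edge_constant_glue (a : vertex G -> R) psi e :
  (forall e, psi e 0 = a (src e)) -> (forall e, psi e 1 = a (tgt e)) ->
  (forall t, psi e t = a (src e)) -> edge_constant (glue a psi) e.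
Proof. by move=> p0 p1 pe t; rewrite glue_char_map//= pe. Qed.

(** On the edge through the point, a cubic vanishing only at [s] and equal to
1 at both ends of the edge; 1 everywhere else. *)
Lemma inner_point_function e0 (s : R) : 0 < s < 1 ->
  exists H : cG -> R, continuous H /\ forall y, H y = 0 <-> y = edge_pt e0 s.
Proof.
move=> s01.
(* The second factor interpolates the two values that normalise [k] at 0 and 1. *)
pose k t := (t - s) ^+ 2 * ((1 - t) / s ^+ 2 + t / (1 - s) ^+ 2).
pose psi e t := if e == e0 then k t else 1.
have k0 : k 0 = 1 by rewrite /k; field; lra.
have k1 : k 1 = 1 by rewrite /k; field; lra.
have psi0 e : psi e 0 = 1 by rewrite /psi; case: ifP.
have psi1 e : psi e 1 = 1 by rewrite /psi; case: ifP.
have kc : continuous k.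
  move=> t; apply: cvgM; first by apply: cvgM; apply: cvgB => //; exact: cvg_cst.
  apply: cvgD; apply: cvgM; try exact: cvg_cst; try exact: cvg_id.
  by apply: cvgB; [exact: cvg_cst|exact: cvg_id].
have psic e : continuous (psi e).
  rewrite (_ : psi e = if e == e0 then k else cst 1).
    by case: ifP => _ //; exact: cst_continuous.
  by apply/funext => t; rewrite /psi; case: ifP.
have hc : continuous (glue (fun=> 1) psi) by apply: glue_continuous.
have [e|H [Hc HS HE]] :=
    extend_to_ends (K := @closed_edge R G e0) hc (@closed_edge_compact _ _ _).
  have [->|/negPf ee0] := eqVneq e e0; first by right.
  by left; apply: edge_constant_glue => // t; rewrite /psi ee0.
have hx x : glue (fun=> 1) psi x = 0 -> x = char_map e0 s.
  case: (realizationP x) => [[v ->] /= /eqP|[e [t [t01 ->]]]].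
    by rewrite oner_eq0.
  rewrite glue_char_map// clamp_id; last lra.
  rewrite /psi; case: eqP => [->|_ /eqP]; last by rewrite oner_eq0.
  move/eqP; rewrite mulf_eq0 sqrf_eq0 => /orP[|].
    by rewrite subr_eq0 => /eqP ->.
  have s2 : 0 < s ^+ 2 by apply: exprn_gt0; lra.
  have s12 : 0 < (1 - s) ^+ 2 by apply: exprn_gt0; lra.
  rewrite gt_eqF// addr_gt0// divr_gt0//; lra.
exists H; split => // y; split => [|->]; last first.
  rewrite HS glue_char_map// clamp_id; last lra.
  by rewrite /psi eqxx /k subrr expr0n mul0r.
case: y => [x|w]; first by rewrite HS => /hx ->.
have [x xK ->] := HE w.
by move=> /hx xE; case: xK; rewrite xE; exists s => //=; rewrite in_itv/=; lra.
Qed.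

(** The squares matter at a loop [e] based at [v]: there an affine interpolation
would vanish on the whole of [e], whereas [(1 - t)^2 + t^2 < 1] inside. *)
Lemma vertex_function v : finite_set [set e | incident v e] ->
  exists H : cG -> R, continuous H /\ forall y, H y = 0 <-> y = vertex_pt R v.
Proof.
move=> vfin.
pose a u : R := 1 - (u == v)%:R.
pose psi e t : R := 1 - (src e == v)%:R * (1 - t) ^+ 2 - (tgt e == v)%:R * t ^+ 2.
have psi0 e : psi e 0 = a (src e) by rewrite /psi/a; ring.
have psi1 e : psi e 1 = a (tgt e) by rewrite /psi/a; ring.
have psic e : continuous (psi e).
  move=> t; apply: cvgB.
    apply: cvgB; first exact: cvg_cst.
    by apply: cvgM; [exact: cvg_cst|apply: cvgM; apply: cvgB => //; exact: cvg_cst].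
  by apply: cvgM; [exact: cvg_cst|apply: cvgM; exact: cvg_id].
have hc : continuous (glue a psi) by apply: glue_continuous.
(* The vertex itself is added for the case that it is isolated. *)
pose K := (\bigcup_(e in [set e | incident v e]) @closed_edge R G e)
  `|` [set VertexPoint R v].
have Kc : compact K.
  by apply: compactU; [exact: closed_edges_compact|exact: compact_set1].
have psi_far e t : ~ incident v e -> psi e t = 1.
  rewrite /psi /incident => ve; case: eqP => [sv|_]; first by case: ve; left.
  by case: eqP => [sv|_]; [case: ve; right|rewrite /=; ring].
have [e|H [Hc HS HE]] := extend_to_ends hc Kc.
  have [ve|ve] := pselect (incident v e).
    by right => x ex; left; exists e.
  left; apply: edge_constant_glue => // t; rewrite psi_far// /a.
  by case: eqP => [sv|_]; [case: ve; left|rewrite /=; ring].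
have hx x : glue a psi x = 0 -> x = VertexPoint R v.
  case: (realizationP x) => [[u ->] /=|[e [t [t01 ->]]]].
    by rewrite /a; case: eqP => [->//|_ /eqP]; rewrite subr0 oner_eq0.
  rewrite glue_char_map// clamp_id; last lra.
  rewrite /psi => E; exfalso; have [t0 t1] := andP t01.
  by move: E; do 2!case: eqP => _; rewrite /= ?mulr1n ?mulr0n; nra.
exists H; split => // y; split => [|->]; last by rewrite HS /= /a eqxx subrr.
case: y => [x|w]; first by rewrite HS => /hx ->.
by have [x xK ->] := HE w; move=> /hx xE; case: xK; right.
Qed.

Lemma point_function (x : rG) : locally_finite G ->
  exists H : cG -> R, continuous H /\ forall y, H y = 0 <-> y = SpacePoint x.
Proof.
move=> Gfin; case: (realizationP x) => [[v ->]|[e [t [t01 ->]]]].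
  exact: vertex_function.
exact: inner_point_function.
Qed.

(** This replaces Hausdorffness of |G| at the points of the graph: the image
of [C] under the function that vanishes at [x] alone is compact, hence closed,
and does not contain 0. *)
Lemma compact_avoid (C : set cG) (x : rG) : locally_finite G ->
  compact C -> ~ C (SpacePoint x) ->
  exists U, [/\ open U, U (SpacePoint x) & U `&` C = set0].
Proof.
move=> Gfin Cc xC; have [H [Hc H0]] := point_function x Gfin.
have HC : closed (H @` C).
  apply: compact_closed; first exact: Rhausdorff.
  by apply: continuous_compact => //; exact: continuous_subspaceT.
exists (H @^-1` (~` (H @` C))); split.
- by apply: open_comp => //; exact: closed_openC.
- by move=> [y Cy]; rewrite ((H0 (SpacePoint x)).2 erefl) => /H0 yx; rewrite yx in Cy.
- by rewrite predeqE => y; split => // -[nHy Cy]; apply: nHy; exists y.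
Qed.

(** This is the affine extension of the indicator function of [X]: it varies
only along the edges of the finite cut, hence it extends to the ends. *)
Lemma cut_function (X : set (vertex G)) : finite_set (edge_cut X) ->
  exists phi : cG -> R, [/\ continuous phi,
    forall y, 0 < phi y < 1 -> exists e t, [/\ edge_cut X e, 0 < t < 1 & y = edge_pt e t] &
    forall e t, edge_cut X e -> 0 <= t <= 1 ->
      phi (edge_pt e t) = if `[< X (src e) >] then 1 - t else t].
Proof.
move=> Xfin.
pose a v : R := `[< X v >]%:R.
pose psi e t : R := a (src e) * (1 - t) + a (tgt e) * t.
have psi0 e : psi e 0 = a (src e) by rewrite /psi; ring.
have psi1 e : psi e 1 = a (tgt e) by rewrite /psi; ring.
have psic e : continuous (psi e).
  move=> t; apply: cvgD; apply: cvgM; try exact: cvg_cst; try exact: cvg_id.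
  by apply: cvgB; [exact: cvg_cst|exact: cvg_id].
have hc : continuous (glue a psi) by apply: glue_continuous.
have psi_far e t : ~ edge_cut X e -> psi e t = a (src e).
  rewrite /psi /a /edge_cut /=; case: asboolP; case: asboolP => //= ? ? cX; try ring.
  - by exfalso; apply: cX; left.
  - by exfalso; apply: cX; right.
have a01 v : a v = 0 \/ a v = 1 by rewrite /a; case: asbool; [right|left].
have [e|H [Hc HS HE]] := extend_to_ends hc (closed_edges_compact Xfin).
  have [eX|eX] := pselect (edge_cut X e); first by right => x ex; exists e.
  by left; apply: edge_constant_glue => // t; exact: psi_far.
have hx x : 0 < glue a psi x < 1 ->
    exists e t, [/\ edge_cut X e, 0 < t < 1 & x = char_map e t].
  case: (realizationP x) => [[u ->] /=|[e [t [t01 ->]]]].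
    by case: (a01 u) => ->; lra.
  rewrite glue_char_map// => p01; exists e, t; split => //.
  apply: contrapT => /psi_far pe; rewrite pe in p01.
  by case: (a01 (src e)) => E; rewrite E in p01; lra.
exists H; split => //.
  case=> [x|w]; first by rewrite HS => /hx[e [t [? ? ->]]]; exists e, t.
  have [x xK ->] := HE w => /hx [e [t [eX t01 xE]]].
  case: xK; exists e => //; rewrite xE; exists t => //=; rewrite in_itv/=; lra.
move=> e t eX t01; rewrite HS glue_char_map// clamp_id// /psi /a.
move: eX; rewrite /edge_cut/=; case: asboolP; case: asboolP => ? ? ; rewrite /= ?mulr1n ?mulr0n => eX; try ring.
- by case: eX => -[].
- by case: eX => -[].
Qed.
End Functions.

(** * Simple loops and the unit circle *)

Definition simple_loop (R : realType) (T : topologicalType) (q : R -> T) : Prop :=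
  [/\ continuous q, q 0 = q 1 &
      forall s t, 0 <= s -> s < t -> t <= 1 -> q s = q t -> s = 0 /\ t = 1].

Lemma continuous_comp_within (S T U : topologicalType) (A : set T)
    (f : T -> U) (g : S -> T) :
  {within A, continuous f} -> continuous g -> (forall t, A (g t)) ->
  continuous (f \o g).
Proof.
move=> /continuousP fc gc gA; apply/continuousP => W oW.
have /open_subspaceP[V oV VW] := fc _ oW.
suff -> : (f \o g) @^-1` W = g @^-1` V by move/continuousP: gc; exact.
rewrite predeqE => t.
have H : (V (g t) /\ A (g t)) = (W (f (g t)) /\ A (g t)).
  exact: (congr1 (fun A => A (g t)) VW).
split=> Wt.
  by have [] : V (g t) /\ A (g t) by rewrite H.
by have [] : W (f (g t)) /\ A (g t) by rewrite -H.
Qed.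

(** The preimage under the induced map of a closed set is the [p]-image of a closed
subset of [[0, 1]], which is compact.  Applied in both directions to two paths
that identify the same parameters, this yields a homeomorphism of their images. *)
Lemma descend_within (R : realType) (S T : topologicalType) (p : R -> S)
    (q : R -> T) :
  continuous p -> continuous q ->
  (forall z K, (p @` `[0, 1]) z -> compact K -> ~ K z ->
     exists U, [/\ open U, U z & U `&` K = set0]) ->
  (forall s t, s \in `[0, 1] -> t \in `[0, 1] -> p s = p t -> q s = q t) ->
  exists f : S -> T, {within p @` `[0, 1], continuous f} /\
    forall t, t \in `[0, 1] -> f (p t) = q t.
Proof.
move=> pc qc sep pq.
have /choice[f fP] (z : S) : exists y : T,
    forall t, t \in `[0, 1] -> p t = z -> y = q t.
  have [[t t01 tz]|nz] := pselect (exists2 t, t \in `[0, 1] & p t = z).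
    by exists (q t) => s s01 sz; apply: pq => //; rewrite sz.
  by exists (q 0) => s s01 sz; case: nz; exists s.
have fq t : t \in `[0, 1] -> f (p t) = q t by move=> t01; exact: fP.
exists f; split => //.
apply/continuousP => W oW; apply/open_subspaceP.
pose Z := `[0, 1] `&` q @^-1` (~` W).
have Zc : compact Z.
  apply: compact_closedI; first exact: segment_compact.
  by apply: preimage_closed => //; exact: open_closedC.
have pZc : compact (p @` Z).
  by apply: continuous_compact => //; exact: continuous_subspaceT.
exists (\bigcup_(U in [set U | open U /\ U `&` p @` Z = set0]) U).
  by apply: bigcup_open => U [].
rewrite predeqE => z; split => -[].
  move=> [U [oU UZ] Uz] [t t01 tz]; split; last by exists t.
  change (W (f z)); rewrite -tz fq//; apply: contrapT => Wt.
  suff : (U `&` p @` Z) z by rewrite UZ.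
  by split => //; exists t.
change (W (f z) -> (p @` `[0, 1]) z ->
  (\bigcup_(U in [set U | open U /\ U `&` p @` Z = set0]) U) z /\ (p @` `[0, 1]) z).
move=> Wz [t t01 tz]; split; last by exists t.
have pz : (p @` `[0, 1]) z by exists t.
have Zz : ~ (p @` Z) z.
  move=> [s [s01 Ws] sz]; apply: Ws; change (W (q s)).
  by rewrite -(fq s)// sz.
have [U [oU Uz UZ]] := sep z _ pz pZc Zz.
by exists U.
Qed.

Section Circle.
Variable R : realType.

(** With [c = 2 t - 1 = cos theta] this is [(2 c^2 - 1, 2 c sqrt (1 - c^2))], that
is, [(cos (2 theta), sin (2 theta))]. *)
Definition circle_path (t : R) : R * R :=
  (1 - 8 * (t * (1 - t)), 4 * (2 * t - 1) * Num.sqrt (t * (1 - t))).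

Lemma circle_path_continuous : continuous circle_path.
Proof.
have uc : continuous (fun t : R => t * (1 - t)).
  move=> t; apply: cvgM; first exact: cvg_id.
  by apply: cvgB; [exact: cvg_cst|exact: cvg_id].
have xc : continuous (fun t : R => 1 - 8 * (t * (1 - t))).
  move=> t; apply: cvgB; first exact: cvg_cst.
  by apply: cvgM; [exact: cvg_cst|exact: uc].
have yc : continuous (fun t : R => 4 * (2 * t - 1) * Num.sqrt (t * (1 - t))).
  move=> t; apply: cvgM.
    apply: cvgM; [exact: cvg_cst|apply: cvgB; [|exact: cvg_cst]].
    by apply: cvgM; [exact: cvg_cst|exact: cvg_id].
  apply: (@continuous_comp _ _ _ (fun t : R => t * (1 - t)) Num.sqrt).
    exact: uc.
  exact: sqrt_continuous.
move=> t; exact: (cvg_pair (xc t) (yc t)).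
Qed.

Lemma circle_path_in (t : R) : 0 <= t <= 1 -> unit_circle R (circle_path t).
Proof.
move=> t01; rewrite /unit_circle /=.
rewrite !exprMn sqr_sqrtr; last by nra.
by ring.
Qed.

Lemma circle_path_simple : simple_loop circle_path.
Proof.
split; first exact: circle_path_continuous.
  by rewrite /circle_path; congr pair; rewrite ?subrr ?mulr0 ?mul0r ?sqrtr0; ring.
move=> s t s0 st t1 [] E1 E2.
have {}E1 : s * (1 - s) = t * (1 - t) by lra.
have ts : t = 1 - s.
  have /eqP : (t - s) * (t + s - 1) = 0 by nra.
  by rewrite mulf_eq0 => /orP[] /eqP; lra.
have : Num.sqrt (t * (1 - t)) = 0.
  by move: E2; rewrite E1 ts; nra.
by move/eqP; rewrite sqrtr_eq0 => u0; split; nra.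
Qed.

Lemma circle_path_surj : circle_path @` `[0, 1] = unit_circle R.
Proof.
rewrite predeqE => z; split.
  by move=> [t /= + <-]; rewrite in_itv/=; exact: circle_path_in.
case: z => x y; rewrite /unit_circle /= => xy.
have x1 : x <= 1 by nra.
have x1' : - 1 <= x by nra.
(* In the notation of [circle_path], [d] is the modulus of [c]; the sign of [c] is that of [y]. *)
pose d := Num.sqrt ((1 + x) / 2).
have d2 : d ^+ 2 = (1 + x) / 2 by rewrite sqr_sqrtr//; nra.
have d0 : 0 <= d by exact: sqrtr_ge0.
have d1 : d <= 1.
  by rewrite -(ler_pXn2r (n := 2))// ?nnegrE// expr1n d2; lra.
have y4 (e : R) : e ^+ 2 = (1 + x) / 2 -> 0 <= e * y ->
    4 * e * Num.sqrt ((1 - x) / 8) = y.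
  move=> e2 ey; apply/eqP.
  have r2 : Num.sqrt ((1 - x) / 8) ^+ 2 = (1 - x) / 8 by rewrite sqr_sqrtr; nra.
  have := sqrtr_ge0 ((1 - x) / 8); move: r2; set r := Num.sqrt _ => r2 r0.
  have /eqP : (4 * e * r - y) * (4 * e * r + y) = 0.
    rewrite -subr_sqr !exprMn e2 r2; nra.
  rewrite mulf_eq0 => /orP[|]; first by rewrite subr_eq0.
  rewrite addr_eq0 => /eqP E; move: ey; rewrite -[y]opprK -E => ey.
  have e0 : e ^+ 2 * r = 0 by nra.
  have /eqP : e * r = 0.
    by apply/eqP; move/eqP: e0; rewrite !mulf_eq0 orbb.
  by move=> /eqP er; apply/eqP; nra.
have [y0|y0] := leP 0 y.
  exists ((1 + d) / 2); first by rewrite /= in_itv/=; lra.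
  have u : (1 + d) / 2 * (1 - (1 + d) / 2) = (1 - x) / 8 by nra.
  rewrite /circle_path u; congr pair; first by field.
  by rewrite -[RHS](y4 d)//; [congr (_ * _ * _); field|nra].
exists ((1 - d) / 2); first by rewrite /= in_itv/=; lra.
have u : (1 - d) / 2 * (1 - (1 - d) / 2) = (1 - x) / 8 by nra.
rewrite /circle_path u; congr pair; first by field.
by rewrite -[RHS](y4 (- d))//; [congr (_ * _ * _); field|rewrite sqrrN|nra].
Qed.
End Circle.

Section Loops.
Variables (R : realType) (G : graph).
Local Notation rG := (realization R G).
Local Notation cG := (freudenthal rG).

Lemma compact_avoid_plane (K : set (R * R)) z : compact K -> ~ K z ->
  exists U, [/\ open U, U z & U `&` K = set0].
Proof.
move=> Kc Kz; exists (~` K); split=> //; last by rewrite setICl.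
by apply: closed_openC; apply: compact_closed => //; exact: norm_hausdorff.
Qed.

Lemma simple_loop_eq (S T : topologicalType) (p : R -> S) (q : R -> T) :
  simple_loop p -> simple_loop q ->
  forall s t, s \in `[0, 1] -> t \in `[0, 1] -> p s = p t -> q s = q t.
Proof.
move=> [_ p01 pI] [_ q01 _] s t; rewrite !in_itv/= => /andP[s0 s1] /andP[t0 t1].
have [st|ts|->//] := ltrgtP s t.
  by move=> /(pI _ _ s0 st t1)[-> ->].
by move=> /esym/(pI _ _ t0 ts s1)[-> ->].
Qed.

Lemma loop_circle (q : R -> cG) : locally_finite G -> simple_loop q ->
  (forall t, exists x, q t = SpacePoint x) -> circle (q @` `[0, 1]).
Proof.
move=> Gfin ql qx; have pl := @circle_path_simple R.
have [qc _ _] := ql; have [pc _ _] := pl.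
(* The standard path on the circle and [q] identify the same parameters. *)
have [f [fc fq]] := descend_within pc qc (fun z K _ => @compact_avoid_plane K z)
  (simple_loop_eq pl ql).
have sep z K : (q @` `[0, 1]) z -> compact K -> ~ K z ->
    exists U, [/\ open U, U z & U `&` K = set0].
  move=> [t _ <-] Kc Kz; have [x E] := qx t; rewrite E in Kz *.
  exact: compact_avoid.
have [g [gc gp]] := descend_within qc pc sep (simple_loop_eq ql pl).
have pU := circle_path_surj R.
exists f, g; rewrite -pU; split => //.
  rewrite predeqE => z; split => [[_ [t t01 <-] <-]|[t t01 <-]].
    by exists t => //; rewrite fq.
  by exists (circle_path t); [exists t|rewrite fq].
by move=> _ /set_mem[t t01 <-]; rewrite fq// gp.
Qed.

(** The last clause allows local arguments at any point of the circle: the base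
point is avoided by using the antipodal parametrization when necessary. *)
Lemma circle_loop (C : set cG) z : circle C -> C z ->
  exists q : R -> cG, [/\ simple_loop q, q @` `[0, 1] = C &
    exists2 t, 0 < t < 1 & q t = z].
Proof.
move=> [f [g [fc gc fC fg]]] Cz.
have [pc p01 pI] := @circle_path_simple R; have pU := circle_path_surj R.
(* The standard path, clamped to be globally defined on the circle; antipodal if [b]. *)
pose p (b : bool) t : R * R := let z := circle_path (clamp t) in
  if b then (- z.1, - z.2) else z.
have pbU b t : unit_circle R (p b t).
  have := circle_path_in (clamp_itv t); rewrite /unit_circle /p.
  by case: b => //=; rewrite !sqrrN.
have pbc b : continuous (p b).
  have cc : continuous (@circle_path R \o @clamp R).
    move=> t; apply: continuous_comp.
      exact: clamp_continuous.
    exact: pc.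
  have c1 : continuous (fst \o (@circle_path R \o @clamp R)).
    by move=> t; apply: continuous_comp; [exact: cc|exact: cvg_fst].
  have c2 : continuous (snd \o (@circle_path R \o @clamp R)).
    by move=> t; apply: continuous_comp; [exact: cc|exact: cvg_snd].
  by case: b => // t; exact: (cvg_pair (cvgN (c1 t)) (cvgN (c2 t))).
have pbI b s t : p b s = p b t -> circle_path (clamp s) = circle_path (clamp t).
  rewrite /p; case: b => //.
  case: (circle_path (clamp s)) => a1 a2; case: (circle_path (clamp t)) => b1 b2.
  by move=> -[] /oppr_inj -> /oppr_inj ->.
have ql b : simple_loop (f \o p b).
  split.
  - by apply: continuous_comp_within fc (pbc b) _ => t; exact: pbU.
  - by rewrite /= /p clamp_le0// clamp_ge1// p01.
  - move=> s t s0 st t1 /= /(congr1 g); rewrite !fg ?mem_set// => /pbI.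
    by rewrite !clamp_id; [exact: pI|lra|lra].
have psurj b w : unit_circle R w -> exists2 t, 0 <= t <= 1 & p b t = w.
  case: w => w1 w2 wU; pose w' := if b then (- w1, - w2) else (w1, w2).
  have : (@circle_path R @` `[0, 1]) w'.
    by rewrite pU; move: wU; rewrite /unit_circle /w'; case: (b) => //=; rewrite !sqrrN.
  move=> [t]; rewrite /= in_itv/= => t01 tw; exists t => //.
  by rewrite /p clamp_id// tw /w'; case: (b) => //=; rewrite !opprK.
have qC b : (f \o p b) @` `[0, 1] = C.
  rewrite -fC predeqE => y; split => [[t _ <-]|[w /(psurj b)[t t01 tw] <-]].
    by exists (p b t) => //; exact: pbU.
  by exists t; rewrite /= ?in_itv// tw.
have [w wU wz] : (f @` unit_circle R) z by rewrite fC.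
have [t /andP[t0 t1] tw] := psurj false w wU.
have [t01|t01] := boolP (0 < t < 1).
  by exists (f \o p false); split => //; exists t => //; rewrite -wz -tw.
exists (f \o p true); split => //; exists (1 / 2); first lra.
have : t = 0 \/ t = 1 by move: t01; rewrite negb_and -!leNgt => /orP[]; [left|right]; lra.
move=> t_or; rewrite /= -wz -tw /p.
congr f.
have -> : circle_path (clamp t) = (1, 0).
  have -> : circle_path (clamp t) = circle_path 0.
    by case: t_or => ->; rewrite ?(@clamp_ge1 R 1) ?p01// clamp_id// lexx ler01.
  by rewrite /circle_path mul0r sqrtr0 !mulr0 subr0.
rewrite clamp_id; last lra.
have h : 2 * (1 / 2) - 1 = 0 :> R by lra.
by rewrite /circle_path h mulr0 mul0r/= oppr0; congr pair; lra.
Qed.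
End Loops.

(** * Circles cross finite cuts evenly *)

(** Changing the sign of [b] to the right of one point of [T] removes that point
from the switching points; without switching points [b] is locally constant on
a connected set. *)
Lemma switch_parity (R : realType) (T : seq R) (b : R -> bool) :
  uniq T -> (forall x, x \in T -> 0 < x < 1) ->
  (forall t, 0 <= t <= 1 -> t \notin T -> \forall s \near t, b s = b t) ->
  (forall t, t \in T ->
     exists c, \forall s \near t, s != t -> b s = (s < t) (+) c) ->
  b 0 (+) b 1 = odd (size T).
Proof.
elim: T b => [|x T IH] b /=.
  move=> _ _ bloc _.
  pose B : set R := `[0, 1] `&` [set t | b t = b 0].
  have BE : B = `[0, 1]%classic.
    apply: (@segment_connected R).
    - by exists 0; split; rewrite //= in_itv/= lexx ler01.
    - exists (interior [set t | b t = b 0]); first exact: open_interior.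
      rewrite predeqE => t; split => -[t01] Bt; split => //.
        move: t01; rewrite /= in_itv/= => t01.
        have : \forall s \near t, b s = b t by exact: bloc.
        by apply: filterS => s /= ->.
      exact: (nbhs_singleton Bt).
    - exists (~` interior [set t | b t <> b 0]).
        by apply: open_closedC; exact: open_interior.
      rewrite predeqE => t; split => -[t01] Bt; split => //.
        by move=> /nbhs_singleton; apply.
      apply: contrapT => nBt; apply: Bt.
      move: t01; rewrite /= in_itv/= => t01.
      have : \forall s \near t, b s = b t by exact: bloc.
      by apply: filterS => s /= ->.
  have [_ /= ->] : B 1 by rewrite BE /= in_itv/= lexx ler01.
  by rewrite addbb.
move=> /andP[xT uT] T01 bloc bsw.
have x01 : 0 < x < 1 by apply: T01; rewrite inE eqxx.
have [c xc] := bsw x (mem_head _ _).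
(* At [x] itself, [b'] takes the common value of its one-sided limits. *)
pose b' s := if s == x then ~~ c else b s (+) (x < s).
have near_side t : t != x -> \forall s \near t, s != x /\ (x < s) = (x < t).
  move=> tx; have [xt|tx'] := ltP x t.
    have : \forall s \near t, x < s by exact: lt_nbhsr.
    by apply: filterS => s xs; rewrite gt_eqF.
  have {}tx' : t < x by rewrite lt_neqAle tx.
  have : \forall s \near t, s < x by exact: lt_nbhsl.
  by apply: filterS => s xs; rewrite lt_eqF// (le_gtF (ltW xs)).
have := IH b' uT.
have -> : b' 0 = b 0.
  have x0 : 0 < x by lra.
  by rewrite /b' (lt_eqF x0) (lt_gtF x0) addbF.
have -> : b' 1 = ~~ b 1.
  have x1 : x < 1 by lra.
  by rewrite /b' (gt_eqF x1) x1 addbT.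
move=> H; rewrite -[RHS]negbK; apply/esym/(canLR negbK).
rewrite -H ?addbN//.
- by rewrite negbK.
- by move=> y yT; apply: T01; rewrite inE yT orbT.
- move=> t t01 tT; have [->|tx] := eqVneq t x.
    move: xc; apply: filterS => s sx; rewrite /b' eqxx; case: eqVneq => // /[dup] ne /sx ->.
    by case: ltgtP ne => // _ _; case: (c).
  have bt : \forall s \near t, b s = b t.
    by apply: bloc => //; rewrite inE negb_or tx.
  have := near_side t tx; move: bt; apply: filterS2 => s bs [sx xs].
  by rewrite /b' (negPf sx) (negPf tx) bs xs.
- move=> t tT; have tx : t != x by apply: contraNneq xT => <-.
  have [|ct bt] := bsw t; first by rewrite inE tT orbT.
  exists (ct (+) (x < t)).
  have := near_side t tx; move: bt; apply: filterS2 => s bs [sx xs] st.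
  by rewrite /b' (negPf sx) bs// xs addbA.
Qed.

Section Crossing.
Variables (R : realType) (G : graph).
Local Notation rG := (realization R G).
Local Notation cG := (freudenthal rG).

Lemma simple_loop_inj (T : topologicalType) (q : R -> T) s t :
  simple_loop q -> 0 < s < 1 -> 0 <= t <= 1 -> q s = q t -> s = t.
Proof.
move=> [_ _ qI] s01 t01; have [st|ts|//] := ltrgtP s t.
  by move=> /(qI _ _ _ st)[]; lra.
by move=> /esym/(qI _ _ _ ts)[]; lra.
Qed.

Variables (X : set (vertex G)) (phi : cG -> R).
Hypothesis phi_continuous : continuous phi.
Hypothesis phi_edge : forall e t, edge_cut X e -> 0 <= t <= 1 ->
  phi (edge_pt e t) = if `[< X (src e) >] then 1 - t else t.
Variable (q : R -> cG).
Hypothesis q_loop : simple_loop q.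

Lemma phi_edge_inj e s t : edge_cut X e -> 0 <= s <= 1 -> 0 <= t <= 1 ->
  phi (edge_pt e s) = phi (edge_pt e t) -> s = t.
Proof. by move=> eX s01 t01; rewrite !phi_edge//; case: asbool; lra. Qed.

(** Close to an inner point of a cut edge the loop stays in that edge, where [phi]
is injective; so [phi] is a continuous injective function of the parameter. *)
Lemma phi_loop_monotonic t0 e s0 : 0 < t0 < 1 -> edge_cut X e -> 0 < s0 < 1 ->
  q t0 = edge_pt e s0 ->
  exists d, [/\ 0 < d,
    forall t, t \in `[t0 - d, t0 + d] ->
      0 < t < 1 /\ exists2 s, 0 < s < 1 & q t = edge_pt e s &
    {in `[t0 - d, t0 + d] &, {homo phi \o q : s t / s < t}} \/
    {in `[t0 - d, t0 + d] &, {homo phi \o q : s t /~ s < t}}].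
Proof.
move=> t01 eX s01 qt0; have [qc _ _] := q_loop.
have near_e : \forall t \near t0,
    0 < t < 1 /\ exists2 s, 0 < s < 1 & q t = edge_pt e s.
  have t0' : \forall t \near t0, 0 < t by apply: lt_nbhsr; lra.
  have t1' : \forall t \near t0, t < 1 by apply: lt_nbhsl; lra.
  have te : \forall t \near t0, [set edge_pt e t | t in [set t | 0 < t < 1]] (q t).
    apply: (qc t0); rewrite qt0; apply: open_nbhs_nbhs; split.
      exact: open_edge_open.
    by exists s0.
  near=> t; split; first by apply/andP; split; near: t.
  have [s s01' <-] : [set edge_pt e t | t in [set t | 0 < t < 1]] (q t) by near: t.
  by exists s.
have [d [d0 dP]] : exists d : R, 0 < d /\ forall t, `|t0 - t| <= d ->
    0 < t < 1 /\ exists2 s, 0 < s < 1 & q t = edge_pt e s.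
  have /nbhsr0P nd := near_e.
  have : \forall d \near (0 : R)^'+, 0 < d /\ forall t, `|t0 - t| <= d ->
    0 < t < 1 /\ exists2 s, 0 < s < 1 & q t = edge_pt e s.
    near=> d; split; near: d; [exact: nbhs_right_gt|exact: nd].
  by move=> /filter_ex.
have dP' t : t \in `[t0 - d, t0 + d] ->
    0 < t < 1 /\ exists2 s, 0 < s < 1 & q t = edge_pt e s.
  by rewrite in_itv/= => td; apply: dP; rewrite ler_norml; lra.
exists d; split => //.
apply: itv_continuous_inj_mono.
  apply: continuous_subspaceT => t; apply: continuous_comp; first exact: qc.
  exact: phi_continuous.
move=> s t /dP'[s01' [u u01 qs]] /dP'[t01' [v v01 qt]] /=.
rewrite qs qt => /phi_edge_inj uv.
apply: (simple_loop_inj q_loop) => //; first lra.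
by rewrite qs qt uv//; lra.
Unshelve. all: by end_near. Qed.

Lemma phi_loop_switch t0 e s0 k : 0 < t0 < 1 -> edge_cut X e -> 0 < s0 < 1 ->
  q t0 = edge_pt e s0 -> phi (q t0) = k ->
  exists c, \forall t \near t0, t != t0 -> (k < phi (q t)) = (t < t0) (+) c.
Proof.
move=> t01 eX s01 qt0 <-.
have [d [d0 _ mono]] := phi_loop_monotonic t01 eX s01 qt0.
have t0d : t0 \in `[t0 - d, t0 + d] by rewrite in_itv/=; lra.
have nd : \forall t \near t0, t \in `[t0 - d, t0 + d].
  have lo : \forall t \near t0, t0 - d < t by apply: lt_nbhsr; lra.
  have hi : \forall t \near t0, t < t0 + d by apply: lt_nbhsl; lra.
  by near=> t; rewrite in_itv/=; apply/andP; split; apply: ltW; near: t.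
case: mono => mono; [exists true|exists false]; move: nd; apply: filterS => t td.
- case: (ltgtP t t0) => // tt0 _ /=.
    by apply/negbTE; rewrite -leNgt; apply/ltW; apply: mono.
  by apply: mono.
- case: (ltgtP t t0) => // tt0 _ /=.
    by apply: mono.
  by apply/negbTE; rewrite -leNgt; apply/ltW; apply: mono.
Unshelve. all: by end_near. Qed.

(** By the intermediate value theorem [phi] takes along the loop all values close
to its value at the point, and on the edge [phi] determines the point. *)
Lemma loop_near_edge t0 e s0 : 0 < t0 < 1 -> edge_cut X e -> 0 < s0 < 1 ->
  q t0 = edge_pt e s0 ->
  \forall s \near s0, exists2 t, 0 <= t <= 1 & q t = edge_pt e s.
Proof.
move=> t01 eX s01 qt0; have [qc _ _] := q_loop.
have [d [d0 dP mono]] := phi_loop_monotonic t01 eX s01 qt0.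
set a := t0 - d in dP mono; set b := t0 + d in dP mono.
have aI : a \in `[a, b] by rewrite in_itv/= lexx /a /b; lra.
have bI : b \in `[a, b] by rewrite in_itv/= lexx /a /b; lra.
have tI : t0 \in `[a, b] by rewrite in_itv/= /a /b; lra.
have at0 : a < t0 by rewrite /a; lra.
have t0b : t0 < b by rewrite /b; lra.
pose m := Num.min (phi (q a)) (phi (q b)); pose M := Num.max (phi (q a)) (phi (q b)).
have mM : m < phi (edge_pt e s0) < M.
  rewrite -qt0 /m /M; case: mono => mono.
    have := mono _ _ aI tI at0; have := mono _ _ tI bI t0b; rewrite /= => h1 h2.
    by rewrite min_l ?max_r ?h1 ?h2//; lra.
  have := mono _ _ tI aI at0; have := mono _ _ bI tI t0b; rewrite /= => h1 h2.
  by rewrite min_r ?max_l ?h1 ?h2//; lra.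
have pc : {for s0, continuous (phi \o edge_pt e)}.
  by apply: continuous_comp; [exact: edge_pt_continuous|exact: phi_continuous].
have [m1 M1] := andP mM.
have sm : \forall s \near s0, m < phi (edge_pt e s) := cvgr_gt _ pc _ m1.
have sM : \forall s \near s0, phi (edge_pt e s) < M := cvgr_lt _ pc _ M1.
have s0' : \forall s \near s0, 0 < s by apply: lt_nbhsr; lra.
have s1' : \forall s \near s0, s < 1 by apply: lt_nbhsl; lra.
near=> s.
have [ms sM' sgt0 slt1] : [/\ m < phi (edge_pt e s), phi (edge_pt e s) < M, 0 < s & s < 1].
  by split; near: s; [exact: sm|exact: sM|exact: s0'|exact: s1'].
have [] := @IVT R (phi \o q) a b (phi (edge_pt e s)).
- by rewrite /a /b; lra.
- apply: continuous_subspaceT => t; apply: continuous_comp; first exact: qc.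
  exact: phi_continuous.
- by rewrite /= (ltW ms) (ltW sM').
- move=> t /dP[t01' [u u01 qt]] /=; rewrite qt => /phi_edge_inj us.
  exists t; first lra.
  by rewrite qt us//; lra.
Unshelve. all: by end_near. Qed.
End Crossing.

Lemma natr_Z2_even n : odd n = false -> n%:R = 0 :> 'Z_2.
Proof.
move=> n2; rewrite -(odd_double_half n) n2 add0n -muln2 natrM.
by rewrite (_ : 2%:R = 0 :> 'Z_2) ?mulr0//; exact/val_inj.
Qed.

Lemma sum_delta_size (G : graph) (A D : set (edge G)) : finite_set A ->
  \sum_(e \in A) delta D e = (size (fset_set (A `&` D)))%:R.
Proof.
move=> Afin; have ADfin : finite_set (A `&` D) by apply: finite_setI; left.
have <- : \sum_(e \in A `&` D) (1 : 'Z_2) = (size (fset_set (A `&` D)))%:R :> 'Z_2.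
  by rewrite fsbig_finite//= big_const_seq count_predT iter_addr_0.
rewrite -[LHS](@fsbig_widen _ _ _ _ (A `&` D)); first last.
- move=> e [Ae nADe]; rewrite /preimage /= /delta indicE memNset// => De.
  exact: nADe.
- by move=> e [].
- by apply: eq_fsbigr => e /set_mem[_ De]; rewrite /delta indicE mem_set.
Qed.

Section CircleCut.
Variables (R : realType) (G : graph).
Hypothesis Gfin : locally_finite G.
Local Notation rG := (realization R G).
Local Notation cG := (freudenthal rG).
Variables (C : set cG) (X : set (vertex G)).
Hypothesis C_circle : circle C.
Hypothesis X_finite : finite_set (edge_cut X).

Lemma circle_nonempty : C !=set0.
Proof.
have [f [g [_ _ <- _]]] := C_circle.
by exists (f (1, 0)), (1, 0) => //; rewrite /unit_circle /= expr1n expr0n addr0.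
Qed.

Lemma circle_compact : compact C.
Proof.
have [z Cz] := circle_nonempty.
have [q [[qc _ _] <- _]] := circle_loop C_circle Cz.
by apply: continuous_compact; [exact: continuous_subspaceT|exact: segment_compact].
Qed.

Lemma edges_inP e : edges_in C e <-> forall t, 0 <= t <= 1 -> C (edge_pt e t).
Proof.
split=> [eC t t01|eC _ [_ [t /= t01 <-] <-]].
  by apply: eC; exists (char_map e t) => //; exists t; rewrite //= in_itv.
by apply: eC; move: t01; rewrite in_itv.
Qed.

(** The parameters of the edge points on [C] form a closed set, since [C] is
compact, and inside the edge an open one, by [loop_near_edge]. *)
Lemma circle_contains_edge e s0 : edge_cut X e -> 0 < s0 < 1 -> C (edge_pt e s0) ->
  edges_in C e.
Proof.
move=> eX s01 Cs0; have [phi [phic _ phie]] := cut_function R X_finite.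
pose Z : set R := [set s | C (edge_pt e s)].
have Zclosed : closed Z.
  rewrite -(setCK Z); apply: open_closedC; rewrite openE => s Zs.
  have [U [oU Us UC]] := compact_avoid Gfin circle_compact Zs.
  have : nbhs s (edge_pt e @^-1` U) by apply: edge_pt_continuous; exact: open_nbhs_nbhs.
  apply: filterS => t Ut Ct; suff : (U `&` C) (edge_pt e t) by rewrite UC.
  by split.
have Z01 : `]0, 1[%classic `&` Z = `]0, 1[%classic.
  apply: (iffRL (connected_intervalP _) (@interval_is_interval R _)).
  - by exists s0; split; rewrite //= in_itv.
  - exists (interior Z); first exact: open_interior.
    rewrite predeqE => s; split=> -[s01'] Zs; split => //; last exact: nbhs_singleton Zs.
    have [q [ql qC [t t01 qt]]] := circle_loop C_circle Zs.
    move: s01'; rewrite /= in_itv/= => s01'.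
    have := loop_near_edge phic phie ql t01 eX s01' qt.
    apply: filterS => u [v v01 qv]; rewrite /Z/= -qv -qC.
    by exists v; rewrite //= in_itv.
  - by exists Z.
have Zoo s : 0 < s < 1 -> Z s.
  by move=> s01'; have [] : (`]0, 1[%classic `&` Z) s by rewrite Z01 /= in_itv.
apply/edges_inP => t t01.
have [t0|t0] := leP t 0.
  have -> : t = 0 by lra.
  apply: (@closed_cvg _ _ (0 : R)^'+ _ id Z Zclosed).
    near=> s; apply: Zoo; apply/andP; split; near: s.
      exact: nbhs_right_gt.
    exact: nbhs_right_lt.
  by apply: cvg_at_right_filter; exact: cvg_id.
have [t1|t1] := leP 1 t.
  have -> : t = 1 by lra.
  apply: (@closed_cvg _ _ (1 : R)^'- _ id Z Zclosed).
    near=> s; apply: Zoo; apply/andP; split; near: s.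
      exact: nbhs_left_gt.
    exact: nbhs_left_lt.
  by apply: cvg_at_left_filter; exact: cvg_id.
by apply: Zoo; lra.
Unshelve. all: by end_near. Qed.

(** The switching points of the predicate [c < phi (q t)] correspond to the cut
edges on the circle, and the predicate has the same value at both ends of the
loop [q]. *)
Lemma circle_meets_cut_evenly : \sum_(e \in edge_cut X) delta (edges_in C) e = 0.
Proof.
rewrite sum_delta_size//; set A := edge_cut X `&` edges_in C.
have Afin : finite_set A by apply: finite_setI; left.
have [phi [phic phi01 phie]] := cut_function R X_finite.
have [z Cz] := circle_nonempty.
have [q [ql qC _]] := circle_loop C_circle Cz.
have [qc q01 _] := ql.
(* The base point may be an inner point of a cut edge, hence a choice of levels. *)
have [c c01 cq] : exists2 c : R, 0 < c < 1 & phi (q 0) <> c.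
  have [E|?] := pselect (phi (q 0) = 1 / 2); last by exists (1 / 2) => //; lra.
  by exists (1 / 3); rewrite ?E; lra.
(* The parameter at which [phi] attains the level [c] on the cut edge [e]. *)
pose lev e : R := if `[< X (src e) >] then 1 - c else c.
have lev01 e : 0 < lev e < 1 by rewrite /lev; case: asbool; lra.
have phi_lev e : edge_cut X e -> phi (edge_pt e (lev e)) = c.
  move=> eX; have l01 := lev01 e; rewrite phie//; last lra.
  by rewrite /lev; case: asbool; lra.
have phi_eq_lev e s : edge_cut X e -> 0 <= s <= 1 -> phi (edge_pt e s) = c -> s = lev e.
  by move=> eX s01; rewrite phie// /lev; case: asbool; lra.
have /choice[tau tauP] (e : edge G) :
    exists t, A e -> 0 < t < 1 /\ q t = edge_pt e (lev e).
  have [[eX eC]|nA] := pselect (A e); last by exists 0.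
  have : C (edge_pt e (lev e)) by have l01 := lev01 e; apply: (edges_inP e).1 => //; lra.
  rewrite -qC => -[t /= + qt]; rewrite in_itv/= => t01; exists t => _; split => //.
  have phiqt : phi (q t) = c by rewrite qt phi_lev.
  have [tE|t0] := eqVneq t 0; first by case: cq; rewrite -phiqt tE.
  have [tE|t1] := eqVneq t 1; first by case: cq; rewrite -phiqt tE q01.
  by rewrite !lt_neqAle eq_sym t0 t1.
pose b t := c < phi (q t).
pose T := map tau (fset_set A).
have memA e : e \in fset_set A -> A e by rewrite in_fset_set// => /set_mem.
have := @switch_parity R T b; rewrite size_map.
have -> : b 0 = b 1 by rewrite /b q01.
rewrite addbb => H; apply: natr_Z2_even; apply/esym/H => {H}.
- rewrite map_inj_in_uniq ?fset_uniq// => e e' /memA Ae /memA Ae' tt'.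
  have [_ qe] := tauP _ Ae; have [_ qe'] := tauP _ Ae'.
  by have [] := edge_pt_inj (lev01 e) (etrans (esym qe) (etrans (congr1 q tt') qe')).
- by move=> _ /mapP[e /memA Ae ->]; have [] := tauP _ Ae.
- move=> t t01 tT.
  have qt : {for t, continuous (phi \o q)}.
    by apply: continuous_comp; [exact: qc|exact: phic].
  rewrite /b; case: (ltgtP c (phi (q t))) => [lt|gt|eq].
  + exact: (cvgr_gt _ qt _ lt).
  + have lt_c : \forall s \near t, phi (q s) < c := cvgr_lt _ qt _ gt.
    near=> s; apply/negbTE; rewrite -leNgt ltW//; near: s; exact: lt_c.
  + have [e [s [eX s01 qs]]] : exists e s, [/\ edge_cut X e, 0 < s < 1 & q t = edge_pt e s].
      by apply: phi01; rewrite -eq.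
    have sE : s = lev e by apply: phi_eq_lev => //; [lra|rewrite -qs].
    have Ae : A e.
      split => //; apply: circle_contains_edge eX s01 _.
      by rewrite -qs -qC; exists t; rewrite //= in_itv.
    have [te qe] := tauP _ Ae.
    case/negP: tT; apply/mapP; exists e; first by rewrite in_fset_set// mem_set.
    apply/esym; apply: (simple_loop_inj ql te t01).
    by rewrite qe qs sE.
- move=> _ /mapP[e /memA Ae ->]; have [te qe] := tauP _ Ae.
  have [eX _] := Ae.
  apply: (phi_loop_switch phic phie ql te eX (lev01 e) qe).
  by rewrite qe phi_lev.
Unshelve. all: by end_near. Qed.
End CircleCut.

(** * Circuits from graph-theoretic cycles *)

Lemma paste_continuous (R : realType) (T : topologicalType) (f g : R -> T) a :
  continuous f -> continuous g -> f a = g a ->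
  continuous (fun t => if t <= a then f t else g t).
Proof.
move=> fc gc fga t W Wt; have {}Wt : nbhs (if t <= a then f t else g t) W by [].
suff : \forall s \near t, W (if s <= a then f s else g s) by [].
have [ta|ta|ta] := ltrgtP t a; move: Wt.
- rewrite (ltW ta) => /fc Wt; have sa : \forall s \near t, s < a by exact: lt_nbhsl.
  near=> s; rewrite ltW; last by near: s.
  by near: s; exact: Wt.
- rewrite leNgt ta /= => /gc Wt; have sa : \forall s \near t, a < s by exact: lt_nbhsr.
  near=> s; rewrite leNgt (_ : a < s) /=; last by near: s.
  by near: s; exact: Wt.
- rewrite ta lexx => Wa; have Wf := fc _ _ Wa.
  rewrite fga in Wa; have Wg := gc _ _ Wa.
  near=> s; case: ifP => _; near: s; [exact: Wf|exact: Wg].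
Unshelve. all: by end_near. Qed.

Section Arcs.
Variables (R : realType) (G : graph).
Local Notation rG := (realization R G).
Local Notation cG := (freudenthal rG).

Definition dir_pt (b : bool) e (s : R) : cG := edge_pt e (if b then 1 - s else s).
Definition dir_src b (e : edge G) := if b then tgt e else src e.
Definition dir_tgt b (e : edge G) := if b then src e else tgt e.

Lemma dir_pt_continuous b e : continuous (dir_pt b e).
Proof.
case: b; last exact: edge_pt_continuous.
move=> s; apply: (@continuous_comp _ _ _ (fun s : R => 1 - s) (edge_pt e)).
  by apply: cvgB; [exact: cvg_cst|exact: cvg_id].
exact: edge_pt_continuous.
Qed.

Lemma dir_pt0 b e : dir_pt b e 0 = vertex_pt R (dir_src b e).
Proof. by rewrite /dir_pt; case: b; [rewrite subr0 edge_pt_ge1|rewrite edge_pt_le0]. Qed.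

Lemma dir_pt_ge1 b e s : 1 <= s -> dir_pt b e s = vertex_pt R (dir_tgt b e).
Proof.
by move=> s1; rewrite /dir_pt; case: b; [rewrite edge_pt_le0//; lra|rewrite edge_pt_ge1].
Qed.

Lemma dir_pt_inner b e s : 0 < s < 1 -> exists2 s', 0 < s' < 1 & dir_pt b e s = edge_pt e s'.
Proof.
by move=> s01; rewrite /dir_pt; exists (if b then 1 - s else s) => //; case: b; lra.
Qed.

Lemma dir_pt_inj b e s t : 0 < s < 1 -> dir_pt b e s = dir_pt b e t -> s = t.
Proof.
move=> s01; rewrite /dir_pt => /edge_pt_inj[]; first by case: b; lra.
by case: b; lra.
Qed.

(** The condition [traces_sub] concerns the whole line and not only [[0, a]], so that
a traced path serves wherever a globally defined path in the graph is expected. *)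
Record traces (q : R -> cG) (a : R) (vs : seq (vertex G)) (D : set (edge G)) : Prop :=
  Traces {
    traces_continuous : continuous q ;
    traces_sub : forall t, (exists2 v, v \in vs & q t = vertex_pt R v) \/
      (exists e s, [/\ D e, 0 < s < 1 & q t = edge_pt e s]) ;
    traces_sup : forall e s, D e -> 0 <= s <= 1 ->
      exists2 t, 0 <= t <= a & q t = edge_pt e s }.

Definition extend_path (q : R -> cG) a b e t : cG :=
  if t <= a then q t else dir_pt b e (t - a).

Lemma extend_path_le q a b e t : t <= a -> extend_path q a b e t = q t.
Proof. by rewrite /extend_path => ->. Qed.

Lemma extend_path_gt q a b e t : a < t -> extend_path q a b e t = dir_pt b e (t - a).
Proof. by rewrite /extend_path leNgt => ->. Qed.

Lemma extend_path_end q a b e : extend_path q a b e (a + 1) = vertex_pt R (dir_tgt b e).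
Proof. by rewrite extend_path_gt ?ltrDl// dir_pt_ge1//; lra. Qed.

Lemma traces_extend_path q a vs D b e w : 0 <= a -> traces q a vs D ->
  q a = vertex_pt R (dir_src b e) -> dir_tgt b e \in w :: vs ->
  traces (extend_path q a b e) (a + 1) (w :: vs) (e |` D).
Proof.
move=> a0 [qc qsub qsup] qa ew; split.
- apply: paste_continuous => //; last by rewrite subrr dir_pt0.
  move=> t; apply: (@continuous_comp _ _ _ (fun t : R => t - a) (dir_pt b e)).
    by apply: cvgB; [exact: cvg_id|exact: cvg_cst].
  exact: dir_pt_continuous.
- move=> t; have [ta|ta] := leP t a.
    rewrite extend_path_le//; have [[v vvs ->]|[e' [s [De' s01 ->]]]] := qsub t.
      by left; exists v => //; rewrite inE vvs orbT.
    by right; exists e', s; split => //; right.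
  rewrite extend_path_gt//; have [t1|t1] := leP 1 (t - a).
    by left; exists (dir_tgt b e) => //; rewrite dir_pt_ge1.
  right; have [|s s01 ->] := @dir_pt_inner b e (t - a); first lra.
  by exists e, s; split => //; left.
- move=> e' s [->|De'] s01; last first.
    have [t ta qt] := qsup _ _ De' s01.
    by exists t; [lra|rewrite extend_path_le//; lra].
  pose s' := if b then 1 - s else s.
  have s'01 : 0 <= s' <= 1 by rewrite /s'; case: (b); lra.
  have E : edge_pt e s = dir_pt b e s'.
    by rewrite /dir_pt /s'; case: (b) => //; congr edge_pt; ring.
  exists (a + s'); first lra.
  have [s0|s0] := leP s' 0.
    have {}s0 : s' = 0 by lra.
    by rewrite E s0 addr0 extend_path_le// qa dir_pt0.
  by rewrite extend_path_gt ?ltrDl// E; congr dir_pt; ring.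
Qed.

(** Stated so as to serve both for prolonging an arc to a new vertex, where the
conclusion is absurd, and for closing it up, where it describes the only
coincidence. *)
Lemma extend_path_inj q a vs D b e s t : traces q a vs D -> ~ D e ->
  (forall s t, 0 <= s -> s < t -> t <= a -> q s <> q t) ->
  0 <= s -> s < t -> t <= a + 1 -> extend_path q a b e s = extend_path q a b e t ->
  [/\ s <= a, t = a + 1 & q s = vertex_pt R (dir_tgt b e)].
Proof.
move=> [_ qsub _] nDe qI s0 st ta1; have [ta|ta] := leP t a.
  by rewrite !extend_path_le//; [move/qI; case|lra].
rewrite (extend_path_gt _ _ _ ta); have [sa|sa] := leP s a.
  rewrite extend_path_le// => qE.
  have [ta1'|ta1'] := leP (a + 1) t.
    have tE : t = a + 1 by lra.
    by split => //; rewrite qE tE dir_pt_ge1//; lra.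
  exfalso; have [|u u01 E] := @dir_pt_inner b e (t - a); first lra.
  rewrite E in qE; have [[v _ qv]|[e' [s' [De' s01 qs]]]] := qsub s.
    by apply: (@edge_pt_neq_vertex R G e u v) => //; rewrite -qE.
  by have [ee' _] := edge_pt_inj u01 (etrans (esym qE) qs); apply: nDe; rewrite ee'.
rewrite extend_path_gt// => /dir_pt_inj; lra.
Qed.

Definition joins (P : set (edge G)) (u v : vertex G) : Prop :=
  exists b e, [/\ P e, dir_src b e = u & dir_tgt b e = v].

(** A repetition-free walk is traversed in time equal to its length, one unit for
each edge.  Each new edge is fresh, because its end is a vertex not visited so far. *)
Lemma path_arc (P : set (edge G)) u p :
  path (fun x y => `[< joins P x y >]) u p -> uniq (u :: p) ->
  exists q D, [/\ traces q (size p)%:R (rev (u :: p)) D,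
    q 0 = vertex_pt R u, q (size p)%:R = vertex_pt R (last u p),
    forall s t, 0 <= s -> s < t -> t <= (size p)%:R -> q s <> q t &
    forall e, D e -> P e /\ (src e \in u :: p) && (tgt e \in u :: p)].
Proof.
elim/last_ind: p => [_ _|p w IH].
  exists (fun=> vertex_pt R u), set0; split => //; last by move=> s t s0 st t0; exfalso; move: t0 => /=; lra.
  split => //; first exact: cst_continuous.
  by move=> t; left; exists u => //; rewrite inE.
rewrite rcons_path => /andP[/IH{}IH /asboolP[b [e [Pe eu ew]]]].
rewrite -rcons_cons rcons_uniq => /andP[wp /IH[q [D [tr q0 qa qI DP]]]].
set a := (size p)%:R in tr qa qI; have a0 : 0 <= a by exact: ler0n.
have nDe : ~ D e.
  move=> /DP[_ /andP[se te]]; move/negP: wp; apply.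
  by rewrite -ew; case: (b).
exists (extend_path q a b e), (e |` D).
rewrite size_rcons -natr1 -/a rev_rcons last_rcons.
split.
- apply: traces_extend_path => //; first by rewrite qa eu.
  by rewrite ew inE eqxx.
- by rewrite extend_path_le.
- by rewrite extend_path_end ew.
- move=> s t s0 st ta /(extend_path_inj tr nDe qI s0 st ta)[sa _ qs].
  have [_ qsub _] := tr.
  have [[v vp qv]|[e' [s' [_ s'01 qs']]]] := qsub s.
    move: qs; rewrite qv => -[vE]; move/negP: wp; apply.
    by rewrite -ew -vE -mem_rev.
  by apply: (@edge_pt_neq_vertex R G e' s' (dir_tgt b e)) => //; rewrite -qs.
- have up : last u p \in u :: p by exact: mem_last.
  have sub v : v \in u :: p -> v \in rcons (u :: p) w.
    by rewrite mem_rcons inE => ->; rewrite orbT.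
  have wr : w \in rcons (u :: p) w by rewrite mem_rcons mem_head.
  move=> e' [->|/DP[Pe' /andP[/sub -> /sub ->]]//].
  by split => //; move: eu ew; case: (b) => /= -> ->; rewrite wr sub.
Qed.

(** Closing the arc from [tgt e] to [src e] by the edge [e].  If [e] is a loop the
arc is a single point; parallel edges are no exception either, as [e] is not
in [P]. *)
Lemma path_circuit (P : set (edge G)) e p : locally_finite G -> ~ P e ->
  path (fun x y => `[< joins P x y >]) (tgt e) p -> last (tgt e) p = src e ->
  exists D, [/\ circuit R D, D e & D `<=` e |` P].
Proof.
move=> Gfin nPe; case/shortenP => {}p ep ue _ pe.
have [q [D [tr q0 qa qI DP]]] := path_arc ep ue.
set a := (size p)%:R in tr qa qI; have a0 : 0 <= a by exact: ler0n.
have nDe : ~ D e by move=> /DP[].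
pose q' := extend_path q a false e.
have tr' : traces q' (a + 1) (tgt e :: rev (tgt e :: p)) (e |` D).
  by apply: traces_extend_path => //; [rewrite qa pe|exact: mem_head].
have [q'c q'sub q'sup] := tr'.
pose l t := q' ((a + 1) * t).
have ll : simple_loop l.
  split.
  - move=> t; apply: (@continuous_comp _ _ _ (fun t : R => (a + 1) * t) q').
      by apply: cvgM; [exact: cvg_cst|exact: cvg_id].
    exact: q'c.
  - by rewrite /l mulr0 mulr1 /q' extend_path_end extend_path_le.
  - move=> s t s0 st t1; rewrite /l.
    have s0' : 0 <= (a + 1) * s by nra.
    have st' : (a + 1) * s < (a + 1) * t by nra.
    have t1' : (a + 1) * t <= a + 1 by nra.
    move=> /(extend_path_inj tr nDe qI s0' st' t1')[sa ta qs]; split; last nra.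
    have [|s00] := leP s 0; first lra.
    have s00' : 0 < (a + 1) * s by nra.
    by have := qI 0 _ (lexx 0) s00' sa; rewrite qs q0.
have lsub z : (l @` `[0, 1]) z <-> exists2 t, 0 <= t <= a + 1 & q' t = z.
  split=> [[t /=]|[t ta <-]].
    by rewrite in_itv/= => t01 <-; exists ((a + 1) * t) => //; nra.
  have a1 : 0 < a + 1 by lra.
  exists (t / (a + 1)); last by rewrite /l mulrC divfK// gt_eqF.
  rewrite /= in_itv/= ler_pdivrMr// ler_pdivlMr//; lra.
have lC : circle (l @` `[0, 1]).
  apply: loop_circle => // t; rewrite /l.
  have [[v _ ->]|[e' [s [_ _ ->]]]] := q'sub ((a + 1) * t).
    by exists (VertexPoint R v).
  by exists (char_map e' s).
have eD e' : edges_in (l @` `[0, 1]) e' <-> (e |` D) e'.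
  rewrite edges_inP; split=> [H|De' t t01]; last first.
    by apply/lsub; exact: q'sup.
  have h01 : 0 < (1 / 2 : R) < 1 by lra.
  have h01' : 0 <= (1 / 2 : R) <= 1 by lra.
  have [t ta q't] := (lsub _).1 (H _ h01').
  have [[v _ qv]|[e'' [s [De'' s01 qs]]]] := q'sub t.
    by exfalso; apply: (@edge_pt_neq_vertex R G e' (1 / 2) v) => //; rewrite -q't qv.
  by have [-> _] := edge_pt_inj h01 (etrans (esym q't) qs).
exists (edges_in (l @` `[0, 1])); split.
- by exists (l @` `[0, 1]).
- by apply/eD; left.
- by move=> e' /eD[|/DP[Pe' _]]; [left|right].
Qed.
End Arcs.

(** * Flows and thin sums of circuits *)

Section Countable.
Variable G : graph.
Hypothesis Gconn : connected_graph G.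
Hypothesis Gfin : locally_finite G.

(** The balls around a vertex are finite, and they exhaust a connected graph. *)
Lemma edge_countable : countable [set: edge G].
Proof.
have [[v0] conn] := Gconn.
pose inc (v : vertex G) := [set e | incident v e].
pose fix ball n : set (vertex G) := if n is m.+1 then
  \bigcup_(v in ball m) (@src G @` inc v `|` @tgt G @` inc v) else [set v0].
have ball_finite n : finite_set (ball n).
  elim: n => [|n IH] /=; first exact: finite_set1.
  apply: bigcup_finite => // v _.
  by rewrite finite_setU; split; apply: finite_image; exact: Gfin.
have reach p n u : ball n u ->
    path (fun x y => `[< Defs.adjacent x y >]) u p -> exists m, ball m (last u p).
  elim: p n u => [|w p IH] n u bu /=; first by exists n.
  move=> /andP[/asboolP[e euw]]; apply: (IH n.+1); exists u => //.
  by case: euw => -[su tw]; [right|left]; exists e => //; [left|right].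
apply: (@sub_countable _ _ _ (\bigcup_(n in setT) \bigcup_(v in ball n) inc v)).
  apply: subset_card_le => e _.
  have [p [pp pl]] := conn v0 (src e).
  have [m bm] := reach p 0%N v0 erefl pp.
  by exists m => //; exists (src e); [rewrite -pl|left].
apply: bigcup_countable => // n _; apply: finite_set_countable.
by apply: bigcup_finite => // v _; exact: Gfin.
Qed.
End Countable.

Lemma Z2_neq0 (x : 'Z_2) : x <> 0 -> x = 1.
Proof. by case: x => -[|[|//]] i /eqP; rewrite // => _; exact/val_inj. Qed.

Lemma addZ2 (x : 'Z_2) : x + x = 0.
Proof. by case: x => -[|[|//]] i; exact/val_inj. Qed.

Section Flow.
Variables (R : realType) (G : graph).
Hypothesis Gfin : locally_finite G.

Lemma Z2_flow_add (f g : edge G -> 'Z_2) :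
  Z2_flow f -> Z2_flow g -> Z2_flow (fun e => f e + g e).
Proof. by move=> ff gf X Xfin; rewrite fsbig_split//= ff// gf// addr0. Qed.

Lemma circuit_flow (D : set (edge G)) : circuit R D -> Z2_flow (delta D).
Proof. by move=> [C Cc ->] X Xfin; exact: circle_meets_cut_evenly. Qed.

(** On a finite cut only finitely many members of a thin family matter, so that the
sums over the cut and over the family can be exchanged. *)
Lemma cycle_space_flow (F : set (edge G)) : cycle_space R G F -> Z2_flow (delta F).
Proof.
move=> [I [D [Dc Dthin DF]]] X Xfin.
pose J := \bigcup_(e in edge_cut X) [set i | D i e].
have Jfin : finite_set J by apply: bigcup_finite => // e _; exact: Dthin.
transitivity (\sum_(e \in edge_cut X) \sum_(i \in J) delta (D i) e).
  apply: eq_fsbigr => e /set_mem eX; rewrite DF; apply/esym/fsbig_widen => //.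
  move=> i [_ nJ]; rewrite /preimage /= /delta indicE memNset// => Die.
  by apply: nJ; exists e.
rewrite exchange_fsbig//; apply: fsbig1 => i _.
by apply: circuit_flow.
Qed.

Variable rank : edge G -> nat.
Hypothesis rank_inj : injective rank.

Lemma rank_finite n : finite_set [set e | (rank e < n)%N].
Proof.
have := finite_II n; apply: (@finite_preimage _ _ _ rank).
by move=> e e' _ _; exact: rank_inj.
Qed.

(** Otherwise the vertices reachable from [tgt e0] by edges of larger rank define a
finite cut on which [f] is nonzero at [e0] only. *)
Lemma circuit_through_first_edge (f : edge G -> 'Z_2) e0 : Z2_flow f ->
  (forall e, (rank e < rank e0)%N -> f e = 0) -> f e0 <> 0 ->
  exists D, [/\ circuit R D, D e0 & forall e, D e -> (rank e0 <= rank e)%N].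
Proof.
move=> ff f0 fe0; pose P := [set e | (rank e0 < rank e)%N].
pose reach v := exists p, path (fun x y => `[< joins P x y >]) (tgt e0) p /\
  last (tgt e0) p = v.
have [[p [pp pl]]|nreach] := pselect (reach (src e0)).
  have [|D [Dc De0 DP]] := @path_circuit R G P e0 p Gfin _ pp pl.
    by rewrite /P /= ltnn.
  by exists D; split => // e /DP[->//|/ltnW].
exfalso; apply: fe0.
have reach_step b e : P e -> reach (dir_src b e) -> reach (dir_tgt b e).
  move=> Pe [p [pp pl]]; exists (rcons p (dir_tgt b e)).
  rewrite rcons_path last_rcons pp pl; split => //=.
  by apply/asboolP; exists b, e.
have cutP e : edge_cut reach e -> (rank e < (rank e0).+1)%N.
  move=> ecut; rewrite ltnS leqNgt; apply/negP => Pe.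
  case: ecut => -[r nr]; apply: nr.
    exact: (@reach_step false).
  exact: (@reach_step true).
have cut_fin : finite_set (edge_cut reach) by exact: (sub_finite_set cutP (rank_finite _)).
rewrite -(ff _ cut_fin) -(@fsbig_widen _ _ _ _ [set e0]) ?fsbig_set1//.
  by move=> _ ->; right; split => //; exists [::].
move=> e [/cutP ecut ne]; rewrite /preimage /=.
by apply: f0; rewrite ltn_neqAle -ltnS ecut andbT; apply/eqP => /rank_inj.
Qed.

(** Greedy elimination: at stage [n] the current flow vanishes on all edges of rank
below [n], and if it does not vanish on the edge of rank [n], a circuit through
this edge is added that avoids all edges of smaller rank. *)
Lemma flow_cycle_space (F : set (edge G)) : Z2_flow (delta F) -> cycle_space R G F.
Proof.
move=> Fflow.
(* [Z (n, f)] is the circuit that cancels [f] at the edge of rank [n], or empty. *)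
have /choice[Z ZP] (nf : nat * (edge G -> 'Z_2)) : exists D : set (edge G),
    Z2_flow nf.2 -> (forall e, (rank e < nf.1)%N -> nf.2 e = 0) ->
    [/\ D = set0 \/ circuit R D, forall e, D e -> (nf.1 <= rank e)%N &
        forall e, rank e = nf.1 -> nf.2 e + delta D e = 0].
  have [[e0 [re0 fe0]]|none] := pselect (exists e, rank e = nf.1 /\ nf.2 e <> 0).
    have [[ff f0]|n] := pselect
        (Z2_flow nf.2 /\ (forall e, (rank e < nf.1)%N -> nf.2 e = 0)); last first.
      by exists set0 => ff f0; case: n.
    rewrite -re0 in f0; have [D [Dc De0 Drank]] := circuit_through_first_edge ff f0 fe0.
    exists D => _ _; split; [by right|by rewrite -re0|move=> e; rewrite -re0 => /rank_inj ->].
    by rewrite (Z2_neq0 fe0) /delta indicE mem_set// addZ2.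
  exists set0 => ff f0; split; [by left|by []|move=> e ree].
  rewrite /delta indicE in_set0 addr0.
  by apply: contrapT => fe; apply: none; exists e.
pose fix fs n : edge G -> 'Z_2 :=
  if n is m.+1 then fun e => fs m e + delta (Z (m, fs m)) e else delta F.
pose D n := Z (n, fs n).
have inv n : Z2_flow (fs n) /\ forall e, (rank e < n)%N -> fs n e = 0.
  elim: n => [|n [ff f0]]; first by split.
  have [Dc Drank De] := ZP (n, fs n) ff f0.
  split; first apply: Z2_flow_add => //.
    case: Dc => [->|/circuit_flow//] X Xfin.
    by apply: fsbig1 => e _; rewrite /delta indicE in_set0.
  move=> e; rewrite ltnS leq_eqVlt => /orP[/eqP/De//|en] /=.
  rewrite f0// add0r /delta indicE memNset// => /Drank /=.
  by rewrite leqNgt en.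
have Dspec n : (D n = set0 \/ circuit R (D n)) /\ forall e, D n e -> (n <= rank e)%N.
  by have [ff f0] := inv n; have [] := ZP (n, fs n) ff f0.
have fsE n e : fs n e = delta F e + \sum_(m < n) delta (D m) e.
  elim: n => [|n IH]; first by rewrite big_ord0 addr0.
  by rewrite big_ord_recr/= IH addrA.
have D0 n e : (rank e < n)%N -> delta (D n) e = 0.
  move=> en; rewrite /delta indicE memNset// => /(Dspec n).2.
  by rewrite leqNgt en.
(* The family may not contain the empty sets of the idle stages. *)
exists {n : nat | `[< circuit R (D n) >]}, (fun i => D (val i)); split.
- by move=> [n /= /asboolP].
- move=> e; apply: (@sub_finite_set _ _ (val @^-1` `I_(rank e).+1)).
    by move=> i /= /(Dspec _).2.
  by apply: finite_preimage (finite_II _) => i j _ _; exact: val_inj.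
- move=> e.
  rewrite -(@fsbig_image _ _ _ _ _ setT val (fun n => delta (D n) e)); last first.
    by move=> i j _ _; exact: val_inj.
  transitivity (\sum_(n \in [set: nat]) delta (D n) e); last first.
    apply/esym/fsbig_widen => // n [_ nval]; rewrite /preimage /=.
    case: (Dspec n).1 => [->|Dc]; first by rewrite /delta indicE in_set0.
    by case: nval; exists (exist _ n (asboolT Dc)).
  rewrite -(@fsbig_widen _ _ _ _ `I_(rank e).+1)//; last first.
    by move=> n [_ /= /negP]; rewrite -leqNgt; exact: D0.
  rewrite -fsbig_ord; have := fsE (rank e).+1 e.
  have [_ ->//] := inv (rank e).+1.
  move=> /(congr1 (fun x => delta F e + x)).
  by rewrite addr0 addrA addZ2 add0r.
Qed.
End Flow.

Theorem theorem8 (R : realType) (G : graph)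
    (Gconn : connected_graph G) (Gfin : locally_finite G) (F : set (edge G)) :
  Z2_flow (delta F) <-> cycle_space R G F.
Proof.
split; last exact: cycle_space_flow.
have /countable_injP[rank rank_inj] := edge_countable Gconn Gfin.
by apply: (@flow_cycle_space R G Gfin rank) => e e'; apply: rank_inj; rewrite in_setT.
Qed.
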